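(* Let $N\ge4$, $d\ge1$, $\kappa\ge0$, and let $x_1(t),\dots,x_N(t)\in\mathbb S^d$, $t\ge0$, be a solution of $$\dot x_i=\frac{\kappa}{N}\sum_{j=1}^N\big(x_j-\langle x_i,x_j\rangle x_i\big),\qquad x_i(0)=x_i^0\in\mathbb S^d,\qquad i=1,\dots,N,$$ with $x_i^0\neq x_j^0$ for all $i\neq j$. If four of the points $x_a,x_b,x_c,x_e$ (with distinct indices) lie on a common circle at $t=0$, then for every $t>0$ the four points $x_a(t),x_b(t),x_c(t),x_e(t)$ lie on a common circle.
   Context: $\mathbb S^d$ is the unit sphere in $\mathbb R^{d+1}$ with Euclidean inner product $\langle\cdot,\cdot\rangle$. A circle means a Euclidean circle in a two-dimensional affine plane of $\mathbb R^{d+1}$. *)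

(* Defs.v *)
From HB Require Import structures.
From mathcomp Require Import all_boot all_order all_algebra.
From mathcomp Require Import all_classical all_reals all_analysis.
Set Implicit Arguments.
Unset Strict Implicit.
Unset Printing Implicit Defensive.
Import Order.TTheory GRing.Theory Num.Theory.
Import numFieldNormedType.Exports.
Local Open Scope classical_set_scope.
Local Open Scope ring_scope.

(* The library's norm `|_| on row vectors is the sup norm, so the Euclidean
   structure is introduced separately. *)
Definition dotp (R : realType) (n : nat) (u v : 'rV[R]_n) : R :=
  \sum_(k < n) u 0 k * v 0 k.

Definition enorm (R : realType) (n : nat) (u : 'rV[R]_n) : R :=
  Num.sqrt (dotp u u).

Definition unit_sphere (R : realType) (d : nat) : set 'rV[R]_d.+1 :=
  [set u | enorm u = 1].

Definition affine_plane (R : realType) (n : nat) (P : set 'rV[R]_n) : Prop :=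
  exists (p : 'rV[R]_n) (W : 'M[R]_(2, n)),
    \rank W = 2%N /\ P = [set q | (q - p <= W)%MS].

Definition circle (R : realType) (n : nat) (C : set 'rV[R]_n) : Prop :=
  exists (P : set 'rV[R]_n) (c : 'rV[R]_n) (r : R),
    [/\ affine_plane P, P c, 0 < r & C = [set q | P q /\ enorm (q - c) = r]].

Definition on_common_circle (R : realType) (n : nat) (p q r s : 'rV[R]_n) :
    Prop :=
  exists C : set 'rV[R]_n, circle C /\ [/\ C p, C q, C r & C s].

Definition sphere_field (R : realType) (N d : nat) (kappa : R)
    (y : 'I_N -> 'rV[R]_d.+1) (i : 'I_N) : 'rV[R]_d.+1 :=
  (kappa / N%:R) *: \sum_(j < N) (y j - dotp (y i) (y j) *: y i).

(* A solution on the closed half-line [0, +oo): the derivative is two-sided at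
   t > 0 and one-sided at t = 0.  Values at t < 0 are unconstrained. *)
Definition sphere_solution (R : realType) (N d : nat) (kappa : R)
    (x0 : 'I_N -> 'rV[R]_d.+1) (x : 'I_N -> R -> 'rV[R]_d.+1) : Prop :=
  [/\ forall (i : 'I_N) (t : R), 0 <= t -> unit_sphere (x i t),
      forall (i : 'I_N) (t : R), 0 < t ->
        is_derive t (1 : R) (x i) (sphere_field kappa (x ^~ t) i),
      forall i, h^-1 *: (x i h - x i 0) @[h --> (0 : R)^'+] -->
        sphere_field kappa (x ^~ 0) i
    & forall i, x i 0 = x0 i].

(* Main.v *)
(* With [w = kappa / N * \sum_j x_j], the quantities
   [D_ij = 1 - <x_i, x_j> = |x_i - x_j|^2 / 2] satisfy
   [D_ij' = - (<w, x_i> + <w, x_j>) * D_ij].  Hence they stay positive and the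
   cross-ratios [D_ab D_ce / (D_ac D_be)] are constant.  Distinct points of the
   sphere are concyclic iff they are affinely dependent, iff the lifts
   [(x_i, 1)] are linearly dependent, iff the matrix of the [D_ij], which is
   minus the Lorentzian Gram matrix of the lifts, is singular; the cross-ratios
   control the latter property. *)
Require Import Defs.
From HB Require Import structures.
From mathcomp Require Import all_boot all_order all_algebra ring lra.
From mathcomp Require Import all_classical all_reals all_analysis.
Import Order.TTheory GRing.Theory Num.Theory.
Import numFieldNormedType.Exports.
Local Open Scope classical_set_scope.
Local Open Scope ring_scope.

(** * Euclidean inner product and unit vectors *)

Section Dotp.
Context {R : realType} {n : nat}.
Implicit Types (u v w : 'rV[R]_n) (k : R).

Lemma dotpC u v : dotp u v = dotp v u.
Proof. by apply: eq_bigr => i _; rewrite mulrC. Qed.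

Lemma dotpDl u v w : dotp (u + v) w = dotp u w + dotp v w.
Proof. by rewrite -big_split; apply: eq_bigr => i _; rewrite mxE mulrDl. Qed.

Lemma dotpZl k u v : dotp (k *: u) v = k * dotp u v.
Proof. by rewrite mulr_sumr; apply: eq_bigr => i _; rewrite mxE mulrA. Qed.

Lemma dotpDr u v w : dotp w (u + v) = dotp w u + dotp w v.
Proof. by rewrite dotpC dotpDl !(dotpC w). Qed.

Lemma dotpZr k u v : dotp u (k *: v) = k * dotp u v.
Proof. by rewrite dotpC dotpZl dotpC. Qed.

Lemma dotpNl u v : dotp (- u) v = - dotp u v.
Proof. by rewrite -scaleN1r dotpZl mulN1r. Qed.

Lemma dotpNr u v : dotp u (- v) = - dotp u v.
Proof. by rewrite dotpC dotpNl dotpC. Qed.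

Lemma dotp0l u : dotp 0 u = 0.
Proof. by rewrite -(scale0r 0) dotpZl mul0r. Qed.

Lemma dotp0r u : dotp u 0 = 0.
Proof. by rewrite dotpC dotp0l. Qed.

Lemma dotp_suml m (f : 'I_m -> 'rV[R]_n) v :
  dotp (\sum_(j < m) f j) v = \sum_(j < m) dotp (f j) v.
Proof.
apply: (big_morph (fun w => dotp w v)); last exact: dotp0l.
by move=> u w; rewrite dotpDl.
Qed.

Definition dotpE := (dotpDl, dotpDr, dotpNl, dotpNr, dotpZl, dotpZr).

Lemma dotp_ge0 u : 0 <= dotp u u.
Proof. by apply: sumr_ge0 => i _; rewrite -expr2 sqr_ge0. Qed.

Lemma dotp_eq0 u : (dotp u u == 0) = (u == 0).
Proof.
apply/eqP/eqP => [/eqP|->]; last exact: dotp0l.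
rewrite psumr_eq0 => [/allP h|i _]; last by rewrite -expr2 sqr_ge0.
apply/rowP => i; have := h i (mem_index_enum i).
by rewrite mulf_eq0 orbb mxE => /eqP.
Qed.

Lemma enormK u : enorm u ^+ 2 = dotp u u.
Proof. by rewrite sqr_sqrtr ?dotp_ge0. Qed.

Lemma enorm1_dotp u : enorm u = 1 -> dotp u u = 1.
Proof. by rewrite -enormK => ->; rewrite expr1n. Qed.

Lemma dotp_unit_le1 u v : dotp u u = 1 -> dotp v v = 1 -> dotp u v <= 1.
Proof.
move=> uu vv; have := dotp_ge0 (u - v); rewrite !dotpE (dotpC v u) uu vv; lra.
Qed.

Lemma dotp_unit_lt1 u v :
  dotp u u = 1 -> dotp v v = 1 -> (dotp u v < 1) = (u != v).
Proof.
move=> uu vv; rewrite -(subr_eq0 u) -dotp_eq0.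
have -> : dotp (u - v) (u - v) = 2 * (1 - dotp u v).
  by rewrite !dotpE (dotpC v u) uu vv; ring.
rewrite mulf_eq0 (pnatr_eq0 R 2) /= subr_eq0 eq_sym lt_neqAle.
by rewrite dotp_unit_le1 // andbT.
Qed.

End Dotp.

(** * Concyclicity of four points of the sphere as a linear condition *)

Section Concyclic.
Context {R : realType} {n : nat}.
Implicit Types (u v p q r s : 'rV[R]_n).

Lemma submx_col_rowP u v z :
  (z <= col_mx u v)%MS <-> exists k l : R, z = k *: u + l *: v.
Proof.
split=> [/submxP[D ->]|[k [l ->]]].
  exists (lsubmx D 0 0), (rsubmx D 0 0).
  by rewrite -{1}(hsubmxK D) mul_row_col (mx11_scalar (lsubmx D))
    (mx11_scalar (rsubmx D)) !mul_scalar_mx !mxE !mulr1n.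
apply/submxP; exists (row_mx k%:M l%:M).
by rewrite mul_row_col !mul_scalar_mx.
Qed.

Lemma row_free_col_mx u v :
  (forall k l : R, k *: u + l *: v = 0 -> k = 0 /\ l = 0) ->
  row_free (col_mx u v).
Proof.
move=> free; apply: inj_row_free => z.
rewrite -(hsubmxK z) mul_row_col (mx11_scalar (lsubmx z)).
rewrite (mx11_scalar (rsubmx z)) !mul_scalar_mx => /free[-> ->].
by rewrite !raddf0 row_mx0.
Qed.

(** A line meets the sphere in at most two points. Algebraically, pairing the relation with [p],
    [q], [r] gives linear equations whose coefficients are the positive half squared chords. *)
Lemma unit_chords_free p q r (b c : R) :
  dotp p p = 1 -> dotp q q = 1 -> dotp r r = 1 ->
  p != q -> p != r -> q != r ->
  b *: (q - p) + c *: (r - p) = 0 -> b = 0 /\ c = 0.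
Proof.
move=> pp qq rr; rewrite -!dotp_unit_lt1 // => pq pr qr eq0.
have := congr1 (dotp p) eq0; have := congr1 (dotp q) eq0.
have := congr1 (dotp r) eq0.
rewrite !dotp0r !dotpE pp qq rr (dotpC q p) (dotpC r p) (dotpC r q).
rewrite -subr_gt0 in pq; rewrite -subr_gt0 in pr; rewrite -subr_gt0 in qr.
move=> hr hq hp.
have hX : b * (1 - dotp p q) + c * (1 - dotp p r) = 0 by lra.
have hY : b * (1 - dotp q r) = (b + c) * (1 - dotp p r) by lra.
have hZ : c * (1 - dotp q r) = (b + c) * (1 - dotp p q) by lra.
move: hX hY hZ pq pr qr.
move: (1 - dotp p q) (1 - dotp p r) (1 - dotp q r) => X Y Z hX hY hZ X0 Y0 Z0.
(* This combination eliminates [c]: by [hY] and [hZ] the first two terms are both [(b + c) * X * Y],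
   with opposite signs. *)
have /eqP : 2 * (X * Z) * b = 0.
  have -> : 2 * (X * Z) * b = X * (b * Z) - Y * (c * Z)
      + Z * (b * X + c * Y) by ring.
  by rewrite hX hY hZ; ring.
rewrite !mulf_eq0 pnatr_eq0 (gt_eqF X0) (gt_eqF Z0) /= => /eqP b0; split=> //.
by move/eqP: hX; rewrite b0 mul0r add0r mulf_eq0 (gt_eqF Y0) orbF => /eqP.
Qed.

(** The three chords from [p] lie in the rank-two direction space of the circle's plane, so the
    matrix stacking them has a nonzero left kernel vector; its entries are the coefficients. *)
Lemma concyclic_affine_dep p q r s : on_common_circle p q r s ->
  exists b c e : R, ~~ [&& b == 0, c == 0 & e == 0] /\
    b *: (q - p) + c *: (r - p) + e *: (s - p) = 0.
Proof.
move=> [C [[P [c0 [r0 [[z0 [W [rkW ->]]] _ _ ->]]]]]].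
move=> /= -[[Wp _] [Wq _] [Wr _] [Ws _]].
have sub z : (z - z0 <= W)%MS -> (z - p <= W)%MS.
  by move=> Wz; rewrite -(subrKA z0) -(opprB p) addmx_sub // eqmx_opp.
have : ~~ row_free (col_mx (q - p) (col_mx (r - p) (s - p))).
  apply/negP => /eqP rk; have : (\rank W < 1 + (1 + 1))%N by rewrite rkW.
  by rewrite -{}rk ltnNge mxrankS // !col_mx_sub !sub.
rewrite -kermx_eq0 => /rowV0Pn[z /sub_kermxP].
rewrite -(hsubmxK z) -(hsubmxK (rsubmx z)) !mul_row_col.
move: (lsubmx z) (lsubmx (rsubmx z)) (rsubmx (rsubmx z)) => z1 z2 z3 rel nz.
exists (z1 0 0), (z2 0 0), (z3 0 0); split.
  apply: contra nz => /and3P[/eqP h1 /eqP h2 /eqP h3].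
  by rewrite (mx11_scalar z1) (mx11_scalar z2) (mx11_scalar z3) h1 h2 h3
    !raddf0 !row_mx0 eqxx.
by rewrite -!mul_scalar_mx -!mx11_scalar -addrA rel.
Qed.

(** The plane through [p], [q], [r] contains [s] and cuts the sphere in a circle, whose centre [m]
    is the orthogonal projection of the origin onto that plane. *)
Lemma affine_dep_concyclic p q r s (b c e : R) :
  dotp p p = 1 -> dotp q q = 1 -> dotp r r = 1 -> dotp s s = 1 ->
  p != q -> p != r -> q != r ->
  ~~ [&& b == 0, c == 0 & e == 0] ->
  b *: (q - p) + c *: (r - p) + e *: (s - p) = 0 ->
  on_common_circle p q r s.
Proof.
move=> pp qq rr ss pq pr qr nz rel.
have free (k l : R) : k *: (q - p) + l *: (r - p) = 0 -> k = 0 /\ l = 0.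
  exact: unit_chords_free.
have e0 : e != 0.
  apply: contra nz => /eqP e0; move: rel.
  by rewrite e0 scale0r addr0 => /free[-> ->]; rewrite !eqxx.
have [k [l sE]] : exists k l : R, s - p = k *: (q - p) + l *: (r - p).
  exists (- b / e), (- c / e); apply: (scalerI e0).
  rewrite [RHS]scalerDr !scalerA !(mulrC e) !divfK // !scaleNr.
  by apply/eqP; rewrite -opprD -addr_eq0 addrC rel.
have pu : dotp p (q - p) = - dotp (q - p) (q - p) / 2.
  by rewrite !dotpE (dotpC q p) pp qq; field.
have pv : dotp p (r - p) = - dotp (r - p) (r - p) / 2.
  by rewrite !dotpE (dotpC r p) pp rr; field.
have qE : q = p + (q - p) by rewrite addrC subrK.
have rE : r = p + (r - p) by rewrite addrC subrK.
move: (q - p) (r - p) => u v in free pu pv sE qE rE *.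
have u0 : u != 0.
  by apply/eqP => u0; move: pq; rewrite qE u0 addr0 eqxx.
(* The Gram determinant of [u], [v]: multiplied by [dotp u u], it is the squared norm of a
   nontrivial combination of them. *)
have G0 : dotp u u * dotp v v - dotp u v ^+ 2 != 0.
  have vv0 : dotp u u != 0 by rewrite dotp_eq0.
  apply/eqP => G0.
  have : dotp (- dotp u v *: u + dotp u u *: v)
              (- dotp u v *: u + dotp u u *: v) = 0.
    rewrite !dotpE (dotpC v u) -[RHS](mulr0 (dotp u u)) -G0; ring.
  move/eqP; rewrite dotp_eq0 => /eqP/free[_ vv].
  by rewrite vv eqxx in vv0.
set G := _ - _ in G0.
(* Cramer's rule for [dotp u m = 0] and [dotp v m = 0], with [p] eliminated through [pu] and
   [pv]. *)
pose x := (dotp u u * dotp v v - dotp u v * dotp v v) / (2 * G).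
pose y := (dotp v v * dotp u u - dotp u v * dotp u u) / (2 * G).
pose m := p + (x *: u + y *: v).
have um : dotp u m = 0.
  rewrite !dotpE (dotpC u p) pu /x /y; rewrite /G in G0 *; field.
  exact: G0.
have vm : dotp v m = 0.
  rewrite !dotpE (dotpC v p) (dotpC v u) pv /x /y; rewrite /G in G0 *; field.
  exact: G0.
have mP : exists k l : R, m - p = k *: u + l *: v.
  by exists x, y; rewrite /m addrC addKr.
clearbody m.
pose rho := enorm (p - m).
(* Since [z - p] is orthogonal to [m], [dotp z m = dotp p m], so the squared distance from [z] to
   [m] does not depend on [z]. *)
have rho_inj z : dotp z z = 1 -> (exists k l : R, z - p = k *: u + l *: v) ->
    enorm (z - m) = rho.
  move=> zz [k' [l' zE]]; rewrite /rho /enorm; congr Num.sqrt.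
  have : dotp (z - p) m = 0 by rewrite zE !dotpE um vm !mulr0 addr0.
  rewrite !dotpDl !dotpNl => /eqP; rewrite subr_eq0 => /eqP zm.
  by rewrite !(dotpDl, dotpDr, dotpNl, dotpNr) !(dotpC m) zm zz pp.
have qP : exists k l : R, q - p = k *: u + l *: v.
  by exists 1, 0; rewrite qE scale1r scale0r addr0 addrC addKr.
have rP : exists k l : R, r - p = k *: u + l *: v.
  by exists 0, 1; rewrite rE scale1r scale0r add0r addrC addKr.
have pP : exists k l : R, p - p = k *: u + l *: v.
  by exists 0, 0; rewrite subrr !scale0r addr0.
(* Radius zero would force [p = m = q]. *)
have rho0 : 0 < rho.
  rewrite lt_neqAle sqrtr_ge0 andbT eq_sym; apply: contra pq => /eqP rho0.
  have eqm z : enorm (z - m) = rho -> z = m.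
    rewrite rho0 => /(congr1 (fun t => t ^+ 2)); rewrite enormK expr0n /=.
    by move/eqP; rewrite dotp_eq0 subr_eq0 => /eqP.
  by rewrite (eqm p) // (eqm q) // rho_inj.
pose P := [set z | (z - p <= (col_mx u v : 'M[R]_(2, n)))%MS].
have PE z : P z <-> exists k l : R, z - p = k *: u + l *: v.
  exact: submx_col_rowP.
exists [set z | P z /\ enorm (z - m) = rho]; split.
  exists P, m, rho; split=> //; last exact/PE.
  by exists p, (col_mx u v); rewrite (eqP (row_free_col_mx _ _ free)).
have sP : exists k l : R, s - p = k *: u + l *: v by exists k, l.
by split; split=> //=; first [exact/PE | exact: rho_inj].
Qed.

(* Let [v] be the combination and [k] the sum of its coefficients.  The
   hypothesis says [<v, z> = k] at the four points, so [|v|^2 = k^2] and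
   [|v - k p|^2 = 0]. *)
Lemma affine_dep_of_ker p q r s (a b c e : R) :
  dotp p p = 1 ->
  (forall z, z \in [:: p; q; r; s] ->
    a * (1 - dotp p z) + b * (1 - dotp q z) + c * (1 - dotp r z)
      + e * (1 - dotp s z) = 0) ->
  b *: (q - p) + c *: (r - p) + e *: (s - p) = 0.
Proof.
move=> pp ker.
pose v := a *: p + b *: q + c *: r + e *: s.
pose k := a + b + c + e.
have vz z : z \in [:: p; q; r; s] -> dotp v z = k.
  by move=> /ker; rewrite !dotpE /k => h; lra.
have vv : dotp v v = k ^+ 2.
  rewrite {2}/v !dotpDr !dotpZr !vz ?inE ?eqxx ?orbT //; rewrite /k; ring.
have -> : b *: (q - p) + c *: (r - p) + e *: (s - p) = v - k *: p.
  by apply/rowP => i; rewrite !mxE /k; ring.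
have vp := vz p (mem_head _ _).
clearbody v k; apply/eqP; rewrite -dotp_eq0 !dotpE (dotpC p) vv vp pp.
by apply/eqP; ring.
Qed.

(* [rho u v] is the factor by which half the squared chord is multiplied; the
   cross-ratio equations make [rho_ij] split as [lambda_i * lambda_j], and a
   kernel vector [c] of the matrix of the [1 - <x_i, x_j>] becomes the kernel
   vector [c_i / lambda_i]. *)
Lemma concyclic_cross_ratio p q r s p' q' r' s'
    (rho := fun u v u' v' : 'rV[R]_n => (1 - dotp u' v') / (1 - dotp u v)) :
  dotp p p = 1 -> dotp q q = 1 -> dotp r r = 1 -> dotp s s = 1 ->
  dotp p' p' = 1 -> dotp q' q' = 1 -> dotp r' r' = 1 -> dotp s' s' = 1 ->
  uniq [:: p; q; r; s] -> uniq [:: p'; q'; r'; s'] ->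
  rho p q p' q' * rho r s r' s' = rho p r p' r' * rho q s q' s' ->
  rho p s p' s' * rho q r q' r' = rho p r p' r' * rho q s q' s' ->
  on_common_circle p q r s -> on_common_circle p' q' r' s'.
Proof.
move=> pp qq rr ss pp' qq' rr' ss' /=.
rewrite !inE !negb_or !andbT => /and3P[/and3P[pq pr ps] /andP[qr qs] rs].
move=> /and3P[/and3P[pq' pr' ps'] /andP[qr' qs'] rs'] e1 e2.
move=> /concyclic_affine_dep[b [c [e [nz rel]]]].
have chord0 u v : dotp u u = 1 -> dotp v v = 1 -> u != v -> 1 - dotp u v != 0.
  by move=> uu vv; rewrite -dotp_unit_lt1 // -subr_gt0 => /lt0r_neq0.
have rhoE u v u' v' : dotp u u = 1 -> dotp v v = 1 -> u != v ->
    1 - dotp u' v' = rho u v u' v' * (1 - dotp u v).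
  by move=> uu vv uv; rewrite divfK ?chord0.
have rho0 u v u' v' : dotp u u = 1 -> dotp v v = 1 -> u != v ->
    dotp u' u' = 1 -> dotp v' v' = 1 -> u' != v' -> rho u v u' v' != 0.
  by move=> *; rewrite mulf_neq0 ?invr_neq0 ?chord0.
have pqE := rhoE p q p' q' pp qq pq; have prE := rhoE p r p' r' pp rr pr.
have psE := rhoE p s p' s' pp ss ps; have qrE := rhoE q r q' r' qq rr qr.
have qsE := rhoE q s q' s' qq ss qs; have rsE := rhoE r s r' s' rr ss rs.
have pq0 : rho p q p' q' != 0 by exact: rho0.
have pr0 : rho p r p' r' != 0 by exact: rho0.
have qr0 : rho q r q' r' != 0 by exact: rho0.
have qs0 : rho q s q' s' != 0 by exact: rho0.
have ker z : b * (dotp q z - dotp p z) + c * (dotp r z - dotp p z)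
    + e * (dotp s z - dotp p z) = 0.
  by rewrite -!dotpNl -!dotpDl -!dotpZl -!dotpDl rel dotp0l.
have := ker s; have := ker r; have := ker q; have {ker} := ker p.
move: e1 e2 pqE prE psE qrE qsE rsE pq0 pr0 qr0 qs0.
move: (rho p q _ _) (rho p r _ _) (rho p s _ _).
move: (rho q r _ _) (rho q s _ _) (rho r s _ _) => {rho rhoE rho0}.
move=> w4 w5 w6 w1 w2 w3 e1 e2 pqE prE psE qrE qsE rsE w10 w20 w40 w50.
rewrite !(dotpC _ p) (dotpC r q) (dotpC s q) (dotpC s r) pp qq rr ss.
move=> kp kq kr ks.
(* With [rho_ij = lambda_i * lambda_j], these are the [c_i / lambda_i] times [lambda_p * lambda_q ^+
   2 * lambda_r * lambda_s]; this scaling makes them polynomial in the [w]s, so no [lambda_i] has to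
   be chosen. *)
apply: (@affine_dep_concyclic _ _ _ _ (b * (w2 * w5)) (c * (w1 * w5))
  (e * (w1 * w4))) => //.
  by rewrite !mulf_eq0 (negPf w10) (negPf w20) (negPf w40) (negPf w50) !orbF.
apply: (@affine_dep_of_ker _ _ _ _ (- (b + c + e) * (w4 * w5))) => // z.
have diag u : dotp u u = 1 -> 1 - dotp u u = 0 by move=> ->; rewrite subrr.
rewrite !inE => /or4P[] /eqP->; rewrite ?(dotpC q' p') ?(dotpC r' p')
  ?(dotpC s' p') ?(dotpC r' q') ?(dotpC s' q') ?(dotpC s' r') ?diag //
  ?pqE ?prE ?psE ?qrE ?qsE ?rsE.
(* Each new row is a multiple of the old one, corrected where needed by multiples of the cross-ratio
   defects [w1 * w6 - w2 * w5] and [w3 * w4 - w2 * w5]. *)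
- transitivity (- w1 * (w2 * w5) * (b * (dotp p q - 1) + c * (dotp p r - 1)
    + e * (dotp p s - 1)) + e * w1 * (1 - dotp p s) * (w3 * w4 - w2 * w5)).
    ring.
  by rewrite e2 kp subrr !mulr0 addr0.
- transitivity (- w1 * (w4 * w5) * (b * (1 - dotp p q)
    + c * (dotp q r - dotp p q) + e * (dotp q s - dotp p q))).
    ring.
  by rewrite kq mulr0.
- transitivity (- w2 * (w4 * w5) * (b * (dotp q r - dotp p r)
    + c * (1 - dotp p r) + e * (dotp r s - dotp p r))
    + e * w4 * (1 - dotp r s) * (w1 * w6 - w2 * w5)).
    ring.
  by rewrite e1 kr subrr !mulr0 addr0.
- transitivity (- (w2 * w5) * w5 * (b * (dotp q s - dotp p s)
    + c * (dotp r s - dotp p s) + e * (1 - dotp p s))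
    - (b + c + e) * w5 * (1 - dotp p s) * (w3 * w4 - w2 * w5)
    + c * w5 * (1 - dotp r s) * (w1 * w6 - w2 * w5)).
    ring.
  by rewrite e1 e2 ks subrr !mulr0 subr0 addr0.
Qed.

End Concyclic.

(** * Calculus of inner products and scalar linear differential equations *)

Lemma cvg_dotp {R : realType} {n : nat} {T : Type} (F : set_system T)
    (f g : T -> 'rV[R]_n) (u v : 'rV[R]_n) : Filter F ->
  f x @[x --> F] --> u -> g x @[x --> F] --> v ->
  dotp (f x) (g x) @[x --> F] --> dotp u v.
Proof.
move=> FF fu gv; apply: cvg_big => [|k _]; first exact: add_continuous.
apply: cvgM.
  exact: (cvg_comp _ (fun w : 'rV[R]_n => w 0 k) fu (@coord_continuous _ _ _ 0 k u)).
exact: (cvg_comp _ (fun w : 'rV[R]_n => w 0 k) gv (@coord_continuous _ _ _ 0 k v)).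
Qed.

Lemma is_derive_dotp {R : realType} {n : nat} (f g : R -> 'rV[R]_n) (t : R)
    (df dg : 'rV[R]_n) :
  is_derive t 1 f df -> is_derive t 1 g dg ->
  is_derive t 1 (fun s => dotp (f s) (g s)) (dotp df (g t) + dotp (f t) dg).
Proof.
have coord (h : R -> 'rV[R]_n) dh k :
    is_derive t 1 h dh -> is_derive t 1 (fun s => h s 0 k) (dh 0 k).
  move=> [dvh <-]; have /derivable_mxP dvhk := dvh.
  by split=> //; rewrite derive_mx // mxE.
move=> fdf gdg.
have -> : (fun s => dotp (f s) (g s)) =
    \sum_(k < n) ((fun s => f s 0 k) * (fun s => g s 0 k)).
  by apply/funext => s; rewrite fct_sumE.
rewrite -big_split /=.
apply: is_derive_sum => k.
have fk := coord _ _ k fdf; have gk := coord _ _ k gdg.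
by apply: is_derive_eq; rewrite /GRing.scale /=; ring.
Qed.

(** Prepares the mean value theorem on [[0, T]]: at the endpoint 0 only a right limit is at hand. *)
Lemma continuous_itv_derive {R : realType} (f df : R -> R) (T : R) : 0 < T ->
  (forall t : R, 0 < t -> is_derive t 1 f (df t)) ->
  f t @[t --> (0 : R)^'+] --> f 0 -> {within `[0, T], continuous f}.
Proof.
move=> T0 fdf f0.
have cf (t : R) : 0 < t -> {for t, continuous f}.
  move=> /fdf[dvf _].
  exact/differentiable_continuous/derivable1_diffP.
apply/(continuous_within_itvP _ T0); split=> //.
  by move=> t /[!in_itv]/= /andP[t0 _]; exact: cf.
exact: cvg_at_left_filter (cf _ T0).
Qed.

(** Integrating factor: [expR (K * t) * f t] has derivative [expR (K * t) * (K + sigma t) * f t],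
    which is nonnegative, so it never drops below [f 0]. *)
Lemma linear_ode_gt0 {R : realType} (f sigma : R -> R) (K T : R) : 0 < T ->
  (forall t : R, 0 <= t -> 0 <= f t) ->
  (forall t : R, 0 < t -> is_derive t 1 f (sigma t * f t)) ->
  (forall t : R, 0 < t -> - K <= sigma t) ->
  f t @[t --> (0 : R)^'+] --> f 0 -> 0 < f 0 -> 0 < f T.
Proof.
move=> T0 f_ge0 fdf sK f0cvg f0.
pose g t := expR (K * t) * f t.
pose dg t := expR (K * t) * ((K + sigma t) * f t).
have gdg (t : R) : 0 < t -> is_derive t 1 g (dg t).
  move=> t0; have ft := fdf _ t0; apply: is_derive_eq.
  rewrite /dg /GRing.scale /=; ring.
have /continuous_itv_derive cg := gdg.
have g0cvg : g t @[t --> (0 : R)^'+] --> g 0.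
  apply: cvgM => //; apply: cvg_at_right_filter.
  apply: continuous_comp; last exact: continuous_expR.
  by apply: cvgM; [exact: cvg_cst|exact: cvg_id].
have gdg' t : t \in `]0, T[%R -> is_derive t 1 g (dg t).
  by rewrite in_itv /= => /andP[t0 _]; exact: gdg.
have [t] := MVT T0 gdg' (cg _ T0 g0cvg).
rewrite in_itv /= => /andP[t0 _] gT.
have : 0 < g T.
  rewrite -(subrK (g 0) (g T)) gT ltr_wpDl //.
    rewrite subr0 !mulr_ge0 ?expR_ge0 ?f_ge0 ?(ltW t0) ?(ltW T0) //.
    by rewrite -lerBlDl sub0r sK.
  by rewrite mulr_gt0 ?expR_gt0.
by rewrite pmulr_rgt0 ?expR_gt0.
Qed.

(** The common rate cancels in the quotient rule, so [g / f] has zero derivative. *)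
Lemma linear_ode_proportional {R : realType} (f g sigma : R -> R) (T : R) :
  0 < T -> (forall t : R, 0 <= t -> f t != 0) ->
  (forall t : R, 0 < t -> is_derive t 1 f (sigma t * f t)) ->
  (forall t : R, 0 < t -> is_derive t 1 g (sigma t * g t)) ->
  f t @[t --> (0 : R)^'+] --> f 0 -> g t @[t --> 0^'+] --> g 0 ->
  g T / f T = g 0 / f 0.
Proof.
move=> T0 f_neq0 fdf gdg f0cvg g0cvg.
pose h t := g t / f t.
have hdh (t : R) : 0 < t -> is_derive t 1 h 0.
  move=> t0; have ft := fdf _ t0; have gt := gdg _ t0.
  have fV := is_deriveV (f_neq0 t (ltW t0)) ft.
  apply: is_derive_eq.
  by rewrite /GRing.scale /=; have := f_neq0 t (ltW t0) => ?; field.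
have h0cvg : h t @[t --> (0 : R)^'+] --> h 0.
  by apply: cvgM => //; apply: cvgV => //; exact: f_neq0.
have hdh' t : t \in `]0, T[%R -> is_derive t 1 h ((fun=> 0) t).
  by rewrite in_itv /= => /andP[t0 _]; exact: hdh.
have [t _] := MVT T0 hdh' (continuous_itv_derive _ _ _ T0 hdh h0cvg).
by rewrite mul0r => /eqP; rewrite subr_eq0 => /eqP.
Qed.

(** * Chords along a solution *)

Section Solution.
Context {R : realType} {N d : nat} {kappa : R}.
Implicit Types y : 'I_N -> 'rV[R]_d.+1.

(* With [w = kappa / N * \sum_k y k] the field is [w - <y i, w> y i]; this is
   the coefficient [<y i, w>]. *)
Definition drift y (i : 'I_N) : R := kappa / N%:R * \sum_(k < N) dotp (y k) (y i).

Lemma dotp_sphere_field y i (z : 'rV[R]_d.+1) :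
  dotp (sphere_field kappa y i) z =
  kappa / N%:R * \sum_(k < N) dotp (y k) z - drift y i * dotp (y i) z.
Proof.
rewrite dotpZl dotp_suml /drift; move: (kappa / _) => K.
rewrite -mulrA -mulrBr; congr (_ * _).
rewrite mulr_suml -sumrB; apply: eq_bigr => k _.
by rewrite dotpDl dotpNl dotpZl (dotpC (y i) (y k)).
Qed.

Lemma drift_le y i : 0 <= kappa -> (forall k, dotp (y k) (y k) = 1) ->
  drift y i <= kappa.
Proof.
(* The index [i] itself witnesses that [N] is positive. *)
move=> kappa0 yy; have N0 : (0 < N)%N by apply: leq_ltn_trans (ltn_ord i).
have N0' : N%:R != 0 :> R by rewrite pnatr_eq0 -lt0n.
rewrite /drift -mulrA ler_piMr // ler_pdivrMl ?ltr0n // mulr1.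
apply: (@le_trans _ _ (\sum_(k < N) 1)).
  by apply: ler_sum => k _; exact: dotp_unit_le1.
by rewrite sumr_const card_ord.
Qed.

Context (x0 : 'I_N -> 'rV[R]_d.+1) (x : 'I_N -> R -> 'rV[R]_d.+1)
  (hsol : sphere_solution kappa x0 x).

Lemma solution_unit i (t : R) : 0 <= t -> dotp (x i t) (x i t) = 1.
Proof. by case: hsol => xS _ _ _ t0; apply: enorm1_dotp; exact: xS. Qed.

(* Half the squared length of the chord, as both points are on the sphere. *)
Let chord i j (t : R) := 1 - dotp (x i t) (x j t).
Let rate i j (t : R) := - (drift (x ^~ t) i + drift (x ^~ t) j).

(** In the derivative of [dotp (x i t) (x j t)] the mean-field terms give the sum of the two drifts
    and the radial terms subtract that sum times the inner product, so the factor [chord i j t]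
    comes out. *)
Lemma is_derive_chord i j (t : R) : 0 < t ->
  is_derive t 1 (chord i j) (rate i j t * chord i j t).
Proof.
move=> t0; case: hsol => _ dx _ _.
have dij := is_derive_dotp _ _ _ _ _ (dx i t t0) (dx j t t0).
have := is_deriveB (is_derive_cst (1 : R) t (1 : R)) dij.
have -> // : 0 - (dotp (sphere_field kappa (x ^~ t) i) (x j t)
    + dotp (x i t) (sphere_field kappa (x ^~ t) j)) = rate i j t * chord i j t.
rewrite (dotpC (x i t)) !dotp_sphere_field /rate /chord -/(drift _ i).
rewrite -/(drift (x ^~ t) j) -/(drift (x ^~ t) i) (dotpC (x j t)); ring.
Qed.

(** For [h > 0], [x i h] is [x i 0] plus [h] times the difference quotient, which converges by the
    one-sided condition at 0. *)
Lemma cvg_at0_solution i : x i t @[t --> (0 : R)^'+] --> x i 0.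
Proof.
case: hsol => _ _ dx0 _.
have h0 : (h : R) @[h --> (0 : R)^'+] --> (0 : R).
  by apply: cvg_within.
have : x i 0 + h *: (h^-1 *: (x i h - x i 0)) @[h --> (0 : R)^'+] -->
    x i 0 + 0 *: sphere_field kappa (x ^~ 0) i.
  by apply: cvgD; [exact: cvg_cst|exact: cvgZ h0 (dx0 i)].
rewrite scale0r addr0; apply: cvg_trans; apply: near_eq_cvg.
near=> h; rewrite /= scalerA divff ?scale1r ?subrKC //.
Unshelve. all: by end_near. Qed.

Lemma cvg_at0_chord i j : chord i j t @[t --> (0 : R)^'+] --> chord i j 0.
Proof.
by apply: cvgB; [exact: cvg_cst|apply: cvg_dotp; exact: cvg_at0_solution].
Qed.

(** Distinct points never collide: each drift is at most [kappa], so the rate is at least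
    [- (kappa + kappa)]. *)
Lemma chord_gt0 (i j : 'I_N) (t : R) :
  0 <= kappa -> x i 0 != x j 0 -> 0 <= t -> 0 < chord i j t.
Proof.
move=> kappa0 xij; rewrite le_eqVlt => /predU1P[<-|t0].
  by rewrite subr_gt0 dotp_unit_lt1 ?solution_unit.
apply: (linear_ode_gt0 _ (rate i j) (kappa + kappa) t t0) => //.
- by move=> s s0; rewrite subr_ge0 dotp_unit_le1 ?solution_unit.
- exact: is_derive_chord.
- move=> s s0; rewrite lerN2 lerD ?drift_le // => k; exact: solution_unit (ltW s0).
- exact: cvg_at0_chord.
- by rewrite subr_gt0 dotp_unit_lt1 ?solution_unit.
Qed.

(** Both chord products use each of the four indices once, so they satisfy the same linear equation
    and keep a constant ratio. *)
Lemma cross_ratio_invariant (i j k l : 'I_N) (t : R) :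
  0 <= kappa -> (forall a b, a != b -> x a 0 != x b 0) -> uniq [:: i; j; k; l] ->
  0 < t ->
  chord i j t / chord i j 0 * (chord k l t / chord k l 0) =
  chord i k t / chord i k 0 * (chord j l t / chord j l 0).
Proof.
move=> kappa0 inj; rewrite /= !inE !negb_or !andbT.
move=> /and3P[/and3P[ij ik il] /andP[jk jl] kl] t0.
have c0 a b (s : R) : a != b -> 0 <= s -> chord a b s != 0.
  by move=> ab s0; rewrite lt0r_neq0 // chord_gt0 ?inj.
(* Minus the sum of the four drifts, the same for every pairing of the indices. *)
pose sigma s := rate i j s + rate k l s.
have dprod a b a' b' (s : R) : rate a b s + rate a' b' s = sigma s -> 0 < s ->
    is_derive s 1 (fun s => chord a b s * chord a' b' s)
      (sigma s * (chord a b s * chord a' b' s)).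
  move=> <- s0.
  have d1 := is_derive_chord a b _ s0; have d2 := is_derive_chord a' b' _ s0.
  by apply: is_derive_eq; rewrite /GRing.scale /=; ring.
have cprod a b a' b' : (chord a b s * chord a' b' s) @[s --> (0 : R)^'+] -->
    chord a b 0 * chord a' b' 0.
  by apply: cvgM; exact: cvg_at0_chord.
have := @linear_ode_proportional _ (fun s => chord i k s * chord j l s)
  (fun s => chord i j s * chord k l s) sigma t t0.
have nz := (c0 i j 0 ij (lexx _), c0 k l 0 kl (lexx _), c0 i k 0 ik (lexx _),
  c0 j l 0 jl (lexx _), c0 i k t ik (ltW t0), c0 j l t jl (ltW t0)).
move=> /(_ _ _ _ (cprod _ _ _ _) (cprod _ _ _ _)) H.
rewrite [LHS]mulf_div [RHS]mulf_div; apply/eqP.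
rewrite eqr_div ?mulf_neq0 ?nz // mulrC; apply/eqP/esym.
have : chord i j t * chord k l t / (chord i k t * chord j l t) =
   chord i j 0 * chord k l 0 / (chord i k 0 * chord j l 0).
  apply: H => s s0; first by rewrite mulf_neq0 ?c0.
    by apply: dprod => //; rewrite /sigma /rate; ring.
  exact: dprod.
move/eqP; rewrite eqr_div ?mulf_neq0 ?nz // => /eqP.
by rewrite mulrC => ->; rewrite mulrC.
Qed.

End Solution.

Theorem corollary4p2 (R : realType) (N d : nat) (kappa : R)
    (x0 : 'I_N -> 'rV[R]_d.+1) (x : 'I_N -> R -> 'rV[R]_d.+1)
    (hN : (4 <= N)%N) (hd : (1 <= d)%N) (hkappa : 0 <= kappa)
    (hx0 : forall i, unit_sphere (x0 i))
    (hdist : forall i j : 'I_N, i <> j -> x0 i <> x0 j)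
    (hsol : sphere_solution kappa x0 x)
    (a b c e : 'I_N) (hidx : uniq [:: a; b; c; e])
    (hcirc : on_common_circle (x a 0) (x b 0) (x c 0) (x e 0)) :
  forall t : R, 0 < t ->
    on_common_circle (x a t) (x b t) (x c t) (x e t).
Proof.
move=> t t0.
have inj0 i j : i != j -> x i 0 != x j 0.
  by case: hsol => _ _ _ xE /eqP ij; rewrite !xE; apply/eqP/hdist.
have unit i (s : R) : 0 <= s -> dotp (x i s) (x i s) = 1.
  exact: (solution_unit _ _ hsol).
have inj (s : R) : 0 <= s -> injective (x ^~ s).
  move=> s0 i j; apply: contra_eq => ij.
  by rewrite -dotp_unit_lt1 ?unit // -subr_gt0 (chord_gt0 _ _ hsol) ?inj0.
have uniq_x (s : R) : 0 <= s -> uniq [:: x a s; x b s; x c s; x e s].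
  by move=> /inj /map_inj_uniq /(_ [:: a; b; c; e]) ->.
have cr i j k l : uniq [:: i; j; k; l] -> _ :=
  fun u => cross_ratio_invariant _ _ hsol i j k l t hkappa inj0 u t0.
apply: concyclic_cross_ratio hcirc; rewrite ?unit ?uniq_x ?(ltW t0) //.
- exact: cr.
(* Up to symmetry of [dotp], the second identity is the invariance for the order [a], [e], [c],
   [b]. *)
- rewrite (dotpC (x b t) (x c t)) (dotpC (x b 0) (x c 0)).
  rewrite (dotpC (x b t) (x e t)) (dotpC (x b 0) (x e 0)).
  apply: (cr a e c b).
  by rewrite -[[:: e; c; b]]/(rev [:: b; c; e]) cons_uniq mem_rev rev_uniq.
Qed.
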